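(* Let $d\ge2$ and $b\ge1$ be integers. For $i,j\in\{0,\dots,d-1\}$ define $$m_{i,j}=\begin{cases}1&\text{if } i=j=0,\\ d-1&\text{if } 0<\max(i,j)<d-1,\\ d+1&\text{if }\max(i,j)=d-1,\end{cases}$$ $$r_{i,j}=\begin{cases}(0,0)&\text{if } i=j=0,\\ (i,\ j+bdi)&\text{if } 0<\max(i,j)<d-1,\\ (1,\ (b+1)d-j)&\text{if } i=d-1,\\ (d-i,\ bd(d-i)+1)&\text{if } j=d-1\end{cases}$$ (the last two cases agree when $i=j=d-1$), and let $T\colon\mathbb Z^2\to\mathbb Z^2$ be the map $$T(x)=\tfrac1d\,(m_{i,j}x+r_{i,j})\quad\text{if } x\equiv(i,j)\bmod d .$$ Then $$\underline\delta(\mathrm{Div}(T))\ \geq\ 1-\frac{1}{\pi}\arccos\!\left(\frac{1}{\sqrt{1+(bd)^{-2}}}\right).$$ In particular, $\underline\delta(\mathrm{Div}(T))$ approaches $1$ as $bd$ tends to infinity. If moreover $d\ge3$, then $\delta(\mathrm{Stop}(T))=1$.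
   Context: $\mathbb R^2$ carries the standard Euclidean norm $\|\cdot\|$, and $\beta(\rho)$ is the closed disc of radius $\rho$ around $0$. For $Z\subseteq\mathbb Z^2$ put $\underline\delta(Z)=\liminf_{n\to\infty}\frac{|Z\cap\beta(n)|}{|\mathbb Z^2\cap\beta(n)|}$ and $\overline\delta(Z)=\limsup_{n\to\infty}\frac{|Z\cap\beta(n)|}{|\mathbb Z^2\cap\beta(n)|}$; if they agree, the common value is the asymptotic density $\delta(Z)$. $\mathrm{Div}(T)$ is the set of points $x\in\mathbb Z^2$ with divergent $T$-trajectory, i.e. such that the sequence $(T^k(x))_{k\in\mathbb N}$ is not eventually periodic. $\mathrm{Stop}(T)$ is the set of points $x\in\mathbb Z^2$ with finite stopping time, i.e. such that $\|T^k(x)\|<\|x\|$ for some integer $k>1$. *)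

(* Defs.v *)
From HB Require Import structures.
From mathcomp Require Import all_boot all_order all_algebra.
From mathcomp Require Import finmap all_classical all_reals all_analysis.
From mathcomp Require Import ring lra zify.
Set Implicit Arguments.
Unset Strict Implicit.
Unset Printing Implicit Defensive.
Import Order.TTheory GRing.Theory Num.Theory.
Local Open Scope classical_set_scope.
Local Open Scope ring_scope.

(* The library norm on pairs is the sup norm, hence this definition. *)
Definition euclidean_norm (R : realType) (x : int * int) : R :=
  Num.sqrt (x.1%:~R ^+ 2 + x.2%:~R ^+ 2).

Definition lattice_disc (R : realType) (rho : R) : set (int * int) :=
  [set x | euclidean_norm R x <= rho].

(* fset_set sends infinite sets to fset0; lattice discs are finite, see
   finite_lattice_disc below. *)
Definition disc_count (R : realType) (Z : set (int * int)) (rho : R) : nat :=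
  #|` fset_set (Z `&` lattice_disc rho)|.

Definition disc_ratio (R : realType) (Z : set (int * int)) : R^nat :=
  fun n => (disc_count Z (n%:R : R))%:R / (disc_count setT (n%:R : R))%:R.

Definition lower_density (R : realType) (Z : set (int * int)) : R :=
  limn_inf (disc_ratio R Z).

Definition upper_density (R : realType) (Z : set (int * int)) : R :=
  limn_sup (disc_ratio R Z).

Definition has_density (R : realType) (Z : set (int * int)) (a : R) : Prop :=
  lower_density R Z = a /\ upper_density R Z = a.

Definition eventually_periodic (A : Type) (u : nat -> A) : Prop :=
  exists N p : nat, (0 < p)%N /\ forall n, (N <= n)%N -> u (n + p)%N = u n.

Definition Div (T : int * int -> int * int) : set (int * int) :=
  [set x | ~ eventually_periodic (fun k => iter k T x)].

Definition Stop (R : realType) (T : int * int -> int * int) : set (int * int) :=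
  [set x | exists2 k : nat, (1 < k)%N &
     euclidean_norm R (iter k T x) < euclidean_norm R x].

(* mcoef and rcoef are only used for 0 <= i, j <= d - 1, so the final branch of
   mcoef is max(i, j) = d - 1 and that of rcoef is j = d - 1. *)
Definition mcoef (d i j : int) : int :=
  if (i == 0) && (j == 0) then 1
  else if Num.max i j < d - 1 then d - 1
  else d + 1.

Definition rcoef (b d i j : int) : int * int :=
  if (i == 0) && (j == 0) then (0, 0)
  else if Num.max i j < d - 1 then (i, j + b * d * i)
  else if i == d - 1 then (1, (b + 1) * d - j)
  else (d - i, b * d * (d - i) + 1).

(* The quotients are exact for 2 <= d, see TmapE below. *)
Definition Tmap (b d : int) (x : int * int) : int * int :=
  let i := (x.1 %% d)%Z in
  let j := (x.2 %% d)%Z in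
  ((mcoef d i j * x.1 + (rcoef b d i j).1) %/ d,
   (mcoef d i j * x.2 + (rcoef b d i j).2) %/ d)%Z.

Lemma TmapE (b d : int) (x : int * int) : 2 <= d ->
  let i := (x.1 %% d)%Z in
  let j := (x.2 %% d)%Z in
  d * (Tmap b d x).1 = mcoef d i j * x.1 + (rcoef b d i j).1 /\
  d * (Tmap b d x).2 = mcoef d i j * x.2 + (rcoef b d i j).2.
Proof.
move=> d2 i j.
have d0 : d != 0 by lia.
have i_lt : i < d by apply: ltz_pmod; lia.
have j_lt : j < d by apply: ltz_pmod; lia.
have x1E := divz_eq x.1 d.
have x2E := divz_eq x.2 d.
rewrite -/i in x1E; rewrite -/j in x2E.
suff [[k1 e1] [k2 e2]] :
  (exists k, mcoef d i j * x.1 + (rcoef b d i j).1 = k * d) /\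
  (exists k, mcoef d i j * x.2 + (rcoef b d i j).2 = k * d).
  by rewrite /Tmap /= -/i -/j e1 e2 !mulzK// !(mulrC d).
rewrite x1E x2E /mcoef /rcoef.
set p := (x.1 %/ d)%Z; set q := (x.2 %/ d)%Z.
case: ifPn => [/andP[/eqP -> /eqP ->]|ij0] /=.
  by split; [exists p | exists q]; ring.
case: ifPn => [ijd|ijd] /=.
  by split; [exists ((d - 1) * p + i) | exists ((d - 1) * q + j + b * i)]; ring.
case: ifPn => [/eqP ->|id] /=.
  by split; [exists ((d + 1) * p + d) | exists ((d + 1) * q + j + b + 1)]; ring.
have -> : j = d - 1 by lia.
by split; [exists ((d + 1) * p + i + 1)
  | exists ((d + 1) * q + d + b * (d - i))]; ring.
Qed.

Lemma finite_lattice_disc (R : realType) (n : nat) :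
  finite_set (lattice_disc (n%:R : R)).
Proof.
have fin1 : finite_set [set a : int | `|a| <= n%:Z].
  apply: (@sub_finite_set _ _
    ((fun k : nat => k%:Z - n%:Z) @` `I_(n + n).+1)).
    move=> a /= an; exists (absz (a + n%:Z)); lia.
  by apply: finite_image; exact: finite_II.
have fin2 := finite_setX fin1 fin1.
apply: sub_finite_set fin2 => -[a c] /=.
rewrite /lattice_disc /euclidean_norm /= => h.
have hs : ((a%:~R : R) ^+ 2 + c%:~R ^+ 2) <= n%:R ^+ 2.
  rewrite -(@sqr_sqrtr _ (_ + _)) ?addr_ge0 ?sqr_ge0//.
  by rewrite lerXn2r ?nnegrE ?sqrtr_ge0.
have {hs} : a ^+ 2 + c ^+ 2 <= n%:Z ^+ 2.
  by rewrite -(ler_int R) rmorphD !rmorphXn.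
by split => /=; nia.
Qed.

(* Main.v *)
Require Import Defs.
From mathcomp Require Import all_boot all_order all_algebra.
From mathcomp Require Import finmap all_classical all_reals all_analysis.
From mathcomp Require Import ring lra zify.
Import numFieldNormedType.Exports.
Import Order.TTheory GRing.Theory Num.Theory.
Local Open Scope ring_scope.

Set Implicit Arguments.
Unset Strict Implicit.
Unset Printing Implicit Defensive.

(** In the coordinates x1 and y = b d x1 - x2 the map T treats both entries alike:
    y is congruent to - x2 modulo d, and if x1 = d p + i and y = d s - j, then a
    step replaces (x1, y) by (p, s), by (x1 - p, y - s), or by
    (x1 + p + 1, y + s - 1) (lemma Tmap_pair_step). So on the cone x1 >= 0, y >= 1, which T preserves, the
    slope x1 / y can only grow; it grows strictly at each expanding step, and y
    decreases strictly at all others. A cycle is therefore impossible, and every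
    trajectory in the cone diverges. Negation exchanges the roles of x1 and y, so
    the opposite cone x1 < 0, y <= 0 diverges as well (lemma Div_cone).

    What remains are two opposite sectors between the vertical axis and the line
    x2 = b d x1, each of opening theta = arctan (1 / (b d)), which is the arccosine
    of the statement. Comparing columns of lattice points with strips of the disc
    bounds the number of lattice points of these sectors by theta n ^ 2 + O(n)
    (lemma sum_column_count_le), and the number of all lattice points of the disc
    from below by pi n ^ 2 - O(n) (lemma disc_count_setT_ge). This gives the lower
    density 1 - theta / pi, which tends to 1 with b d as theta <= 1 / (b d).

    For stopping times, the first k multipliers depend on x modulo d ^ k only.
    Each multiplier is prime to d, so they behave as k independent uniform choices
    among the d ^ 2 residue classes. The mean of m / d is at most 1 for d >= 3, so
    the mean rho of sqrt (m / d) is less than 1 (lemma sum_root_mult_lt), and by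
    Markov's inequality the k-step product is at least d ^ k on a proportion at
    most rho ^ k of the residues modulo d ^ k. For all other x outside a bounded
    set the norm has decreased after k steps (lemma Stop_of_mprod), because T
    differs from a homothety by a bounded amount on each class. Letting k grow
    shows that the points with finite stopping time have density 1. *)

(** * Trajectories in the two cones *)

(** The dynamics in the coordinates A = x1 and B = height x. Writing A = d p + i
    and B = d s - j, the three alternatives are the residue class of 0, the
    classes with multiplier d - 1, and those with multiplier d + 1: the
    remainders r_(i,j) are chosen so that all offsets cancel except for the
    + 1 on A and the - 1 on B in the last alternative. *)
Definition pair_step (d A B A' B' : int) : Prop :=
  exists p s i j : int,
    [/\ A = d * p + i, B = d * s - j, 0 <= i < d & 0 <= j < d] /\
    [\/ [/\ i = 0, j = 0, A' = p & B' = s],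
        [/\ i < d - 1, j < d - 1, A' = A - p & B' = B - s]
      | A' = A + p + 1 /\ B' = B + s - 1].

(** Negation swaps floors with ceilings, hence the roles of the two coordinates;
    this carries everything proved on one cone over to the opposite cone. *)
Lemma pair_stepN d A B A' B' :
  pair_step d A B A' B' -> pair_step d (- B) (- A) (- B') (- A').
Proof.
case=> p [s [i [j [[AE BE i_d j_d] H]]]].
exists (- s), (- p), j, i; split; first by split=> //; lia.
case: H => [[-> -> -> ->]|[? ? -> ->]|[-> ->]].
- by constructor 1.
- by constructor 2; split=> //; lia.
- by constructor 3; split; lia.
Qed.

(** The linear form vanishing on the line x2 = b d x1; it is congruent to - x2
    modulo d. *)
Definition height (b d : int) (x : int * int) : int := b * d * x.1 - x.2.

Lemma Tmap_pair_step b d x : 2 <= d ->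
  pair_step d x.1 (height b d x) (Tmap b d x).1 (height b d (Tmap b d x)).
Proof.
move=> d2; have [e1 e2] := TmapE b x d2.
have i_lt : (x.1 %% d)%Z < d by apply: ltz_pmod; lia.
have j_lt : (x.2 %% d)%Z < d by apply: ltz_pmod; lia.
have i_ge : 0 <= (x.1 %% d)%Z by apply: modz_ge0; lia.
have j_ge : 0 <= (x.2 %% d)%Z by apply: modz_ge0; lia.
have x1E := divz_eq x.1 d.
have x2E := divz_eq x.2 d.
have dI : injective ( *%R d) by apply: mulfI; lia.
move: (Tmap b d x) => z in e1 e2 *.
rewrite /height; move: x1E x2E e1 e2 i_lt i_ge j_lt j_ge.
move: (x.1 %% d)%Z (x.2 %% d)%Z (x.1 %/ d)%Z (x.2 %/ d)%Z => i j p q x1E x2E.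
rewrite /mcoef /rcoef => e1 e2 i_lt i_ge j_lt j_ge.
exists p, (b * x.1 - q), i, j; split.
  by split; [rewrite x1E; ring | rewrite x2E; ring | lia | lia].
move: e1 e2; case: ifPn => [/andP[/eqP i0 /eqP j0]|ij0] /=.
  move=> e1 e2; constructor 1.
  have z1 : z.1 = p by apply: dI; rewrite e1 x1E i0; ring.
  by split=> //; rewrite z1; apply: dI; rewrite mulrBr e2 x2E x1E i0 j0; ring.
case: ifPn => [ijd|ijd] /=.
  move=> e1 e2; constructor 2.
  have z1 : z.1 = x.1 - p by apply: dI; rewrite e1 x1E; ring.
  split=> //; [lia|lia|].
  by rewrite z1; apply: dI; rewrite mulrBr e2 x2E x1E; ring.
case: ifPn => [/eqP id|id] /= e1 e2; constructor 3.
  have z1 : z.1 = x.1 + p + 1 by apply: dI; rewrite e1 x1E id; ring.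
  by split=> //; rewrite z1; apply: dI; rewrite mulrBr e2 x2E x1E id; ring.
have jd : j = d - 1 by lia.
have z1 : z.1 = x.1 + p + 1 by apply: dI; rewrite e1 x1E; ring.
by split=> //; rewrite z1; apply: dI; rewrite mulrBr e2 x2E x1E jd; ring.
Qed.

(** On the cone A >= 0, B >= 1 the slope A / B never decreases, because rounding
    always favours A over B: A loses floor(A / d) and B loses ceil(B / d), or A
    gains floor(A / d) + 1 and B gains ceil(B / d) - 1. The slope increases
    strictly in the expanding classes, and B decreases strictly in all others. *)
Lemma pair_step_slope d A B A' B' : 2 <= d -> 0 <= A -> 1 <= B ->
  pair_step d A B A' B' ->
  [/\ 0 <= A', 1 <= B', A * B' <= A' * B & A * B' < A' * B \/ B' < B].
Proof.
move=> d2 A0 B1 [p [s [i [j [[AE BE /andP[i0 id] /andP[j0 jd]] H]]]]].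
have p0 : 0 <= p by nia.
have s1 : 1 <= s by nia.
case: H => [[i0' j0' -> ->]|[id' jd' -> ->]|[-> ->]].
- by split; [lia|lia|nia|right; nia].
- split; [nia|nia| |right; lia].
  suff : 0 <= A * s - p * B by lia.
  have -> : A * s - p * B = i * s + p * j by rewrite AE BE; ring.
  nia.
- have lt : A * (B + s - 1) < (A + p + 1) * B.
    suff : 0 < (p + 1) * B - A * (s - 1) by lia.
    have -> : (p + 1) * B - A * (s - 1) =
      (p + 1) * (d - j) + (d - i) * (s - 1) by rewrite AE BE; ring.
    have : 0 <= (d - i) * (s - 1) by nia.
    have : 0 <= p * (d - j) by nia.
    lia.
  by split; [lia|lia|lia|left].
Qed.

(** Around a cycle the slope would be constant, so no step would be expanding, so
    B would decrease strictly at every step. *)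
Lemma pair_step_aperiodic d (A B : nat -> int) (p : nat) : 2 <= d ->
  0 <= A 0%N -> 1 <= B 0%N ->
  (forall k, pair_step d (A k) (B k) (A k.+1) (B k.+1)) ->
  (0 < p)%N -> A p = A 0%N -> B p = B 0%N -> False.
Proof.
move=> d2 A0 B0 step p0 Ap Bp.
have H k : [/\ 0 <= A k, 1 <= B k, A 0%N * B k <= A k * B 0%N &
   A 0%N * B k < A k * B 0%N \/ B k <= B 0%N - k%:Z].
  elim: k => [|k [Ak Bk le lt]]; first by split=> //; right; lia.
  have [Ak' Bk' le' lt'] := pair_step_slope d2 Ak Bk (step k).
  have h1 : A 0%N * B k * B k.+1 <= A k * B 0%N * B k.+1.
    by apply: ler_wpM2r => //; lia.
  have h2 : A k * B k.+1 * B 0%N <= A k.+1 * B k * B 0%N.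
    by apply: ler_wpM2r => //; lia.
  split=> //.
    have Bk0 : 0 < B k by lia.
    rewrite -(ler_pM2r Bk0); lia.
  have [s1|s1] : A 0%N * B k < A k * B 0%N \/ ~~ (A 0%N * B k < A k * B 0%N)
    by case: (A 0%N * B k < A k * B 0%N); [left|right].
    left; have Bk0 : 0 < B k by lia.
    have : A 0%N * B k * B k.+1 < A k * B 0%N * B k.+1.
      by rewrite ltr_pM2r //; lia.
    by move=> h3; rewrite -(ltr_pM2r Bk0); lia.
  case: lt' => [s2|s2].
    left; have Bk0 : 0 < B k by lia.
    have : A k * B k.+1 * B 0%N < A k.+1 * B k * B 0%N.
      by rewrite ltr_pM2r //; lia.
    by move=> h3; rewrite -(ltr_pM2r Bk0); lia.
  by right; case: lt => [|lt]; lia.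
have [_ _ _] := H p; rewrite Ap Bp => -[]; lia.
Qed.

Lemma pair_step_not_eventually_periodic d (T : Type) (u : nat -> T)
    (A B : T -> int) : 2 <= d ->
  0 <= A (u 0%N) -> 1 <= B (u 0%N) ->
  (forall k, pair_step d (A (u k)) (B (u k)) (A (u k.+1)) (B (u k.+1))) ->
  ~ eventually_periodic u.
Proof.
move=> d2 A0 B0 step [N [p [p0 per]]].
have cone k : 0 <= A (u k) /\ 1 <= B (u k).
  elim: k => [//|k [Ak Bk]].
  by have [] := pair_step_slope d2 Ak Bk (step k).
apply: (@pair_step_aperiodic d (fun k => A (u (N + k)%N))
  (fun k => B (u (N + k)%N)) p d2) => //; rewrite ?addn0 ?per //.
- by have [] := cone N.
- by have [] := cone N.
- by move=> k; rewrite addnS; exact: step.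
Qed.

Lemma Div_cone b d x : 2 <= d ->
  0 <= x.1 /\ 1 <= height b d x \/ x.1 <= -1 /\ height b d x <= 0 ->
  Div (Tmap b d) x.
Proof.
move=> d2 [[x1 hx]|[x1 hx]].
  apply: (pair_step_not_eventually_periodic (A := fst) (B := height b d) d2) => //.
  by move=> k; rewrite iterS; exact: Tmap_pair_step.
apply: (pair_step_not_eventually_periodic (A := fun x => - height b d x)
  (B := fun x : int * int => - x.1) d2) => /=.
- by rewrite oppr_ge0.
- by rewrite lerNr.
by move=> k; apply: pair_stepN; exact: Tmap_pair_step.
Qed.

(** * Areas of circular strips *)

Lemma derive_ge0_le (R : realType) (f f' : R -> R) (a b : R) :
  (forall x : R, is_derive x 1 f (f' x)) ->
  (forall x, a <= x <= b -> 0 <= f' x) -> a <= b -> f a <= f b.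
Proof.
move=> df f'0 ab.
apply: (@ger0_derive1_ndecr R f a b) => //.
- by move=> x; rewrite in_itv /= => /andP[/ltW ax /ltW xb];
  rewrite derive1E derive_val f'0 ?ax.
- apply: continuous_subspaceT => x; apply: differentiable_continuous.
  by apply/derivable1_diffP.
Qed.

Lemma sin_le_id (R : realType) (x : R) : 0 <= x -> sin x <= x.
Proof.
move=> x0; rewrite -subr_ge0.
have := @derive_ge0_le R (fun x => x - sin x) (fun x => 1 - cos x) 0 x.
by rewrite sin0 subrr; apply.
Qed.

(** A primitive of sqrt (1 - t ^ 2) on [0, 1]. *)
Definition circle_primitive (R : realType) (t : R) : R :=
  (t * Num.sqrt (1 - t ^+ 2) + asin t) / 2.

Section CirclePrimitive.
Variable R : realType.
Implicit Types s t : R.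

Let asin_sub s t : 0 <= s -> s <= t -> t <= 1 ->
  [/\ 0 <= asin s, asin s <= asin t & asin t <= pi / 2].
Proof.
move=> s0 st t1.
have s1 : -1 <= s <= 1 by apply/andP; split; lra.
have t1' : -1 <= t <= 1 by apply/andP; split; lra.
have mono (x y : R) : -1 <= x <= 1 -> -1 <= y <= 1 -> x <= y -> asin x <= asin y.
  move=> hx hy; rewrite !leNgt; apply: contra => lt.
  have := lt; rewrite -ltr_sin ?asinK ?in_itv /= ?asin_geNpi2 ?asin_lepi2 //.
split; [|exact: mono|exact: asin_lepi2].
have := mono 0 s; rewrite -[X in asin X]sin0 sinK; last first.
  by rewrite in_itv /=; have := pi_ge0 R; lra.
by apply => //; lra.
Qed.

Let cos_asin_le s t : 0 <= s -> s <= t -> t <= 1 ->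
  Num.sqrt (1 - t ^+ 2) <= Num.sqrt (1 - s ^+ 2).
Proof. by move=> s0 st t1; apply: ler_wsqrtr; rewrite lerD2l lerN2; nra. Qed.

(** With s = sin u and t = sin v this is sin (v - u) <= v - u up to the term
    (sin v - sin u) (cos u - cos v), which is nonnegative. *)
Lemma circle_primitive_ge s t : 0 <= s -> s <= t -> t <= 1 ->
  (t - s) * Num.sqrt (1 - t ^+ 2) <=
  circle_primitive t - circle_primitive s.
Proof.
move=> s0 st t1; have [a0 ab bpi] := asin_sub s0 st t1.
have cle := cos_asin_le s0 st t1.
have := sin_le_id (x := asin t - asin s); rewrite subr_ge0 => /(_ ab).
rewrite sinB !asinK ?in_itv /= ?cos_asin /circle_primitive; try lra.
set ct := Num.sqrt (1 - t ^+ 2) in cle *.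
set cs := Num.sqrt (1 - s ^+ 2) in cle *.
move: (asin s) (asin t) => a b h.
have : 0 <= (t - s) * (cs - ct) by apply: mulr_ge0; lra.
lra.
Qed.

(** In the angle v = asin t, the difference of the two sides has derivative
    proportional to cos v (cos u - cos v), which is nonnegative for u <= v; in
    this variable the endpoint t = 1 is not singular. *)
Lemma circle_primitive_le s t : 0 <= s -> s <= t -> t <= 1 ->
  circle_primitive t - circle_primitive s <=
  (t - s) * Num.sqrt (1 - s ^+ 2).
Proof.
move=> s0 st t1; have [a0 ab bpi] := asin_sub s0 st t1.
have h : 2 * (cos (asin s) * sin (asin s)) - asin s - sin (asin s) * cos (asin s)
  <= 2 * (cos (asin s) * sin (asin t)) - asin t - sin (asin t) * cos (asin t).
  apply: (@derive_ge0_le R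
    (fun x => 2 * (cos (asin s) * sin x) - x - sin x * cos x)
    (fun x => 2 * cos x * (cos (asin s) - cos x))) => // x.
    apply: is_derive_eq.
    rewrite /GRing.scale /=; have := cos2sin2 x; lra.
  move=> /andP[ax xb].
  have cx : 0 <= cos x by apply: cos_ge0_pihalf; lra.
  suff : cos x <= cos (asin s) by move=> h; rewrite mulr_ge0 ?subr_ge0 ?mulr_ge0.
  rewrite leNgt ltr_cos ?in_itv /=; have := pi_ge0 R; try lra.
move: h.
rewrite !asinK ?in_itv /= ?cos_asin /circle_primitive; try lra.
Qed.
End CirclePrimitive.

(** * Columns of lattice points *)

Section Sectors.
Variable R : realType.

Lemma circle_primitive0 : circle_primitive (0 : R) = 0.
Proof.
rewrite /circle_primitive mul0r add0r -[X in asin X]sin0 sinK ?mul0r//.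
by rewrite in_itv /=; have := pi_ge0 R; lra.
Qed.

Lemma circle_primitive1 : circle_primitive (1 : R) = pi / 4.
Proof.
rewrite /circle_primitive expr1n subrr sqrtr0 mulr0 add0r -[X in asin X]sin_pihalf sinK.
  by field.
by rewrite in_itv /=; have := pi_ge0 R; lra.
Qed.

(** Half the length of the chord of the circle of radius n at abscissa i; it is
    0 for i >= n, as Num.sqrt vanishes on negative numbers. *)
Definition chord (n i : nat) : R := Num.sqrt (n%:R ^+ 2 - i%:R ^+ 2).

Lemma chordE n i : (0 < n)%N ->
  chord n i = n%:R * Num.sqrt (1 - (i%:R / n%:R) ^+ 2).
Proof.
move=> n0; have n0' : 0 < n%:R :> R by rewrite ltr0n.
rewrite -[X in X * _]gtr0_norm // -sqrtr_sqr -sqrtrM ?sqr_ge0 //.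
by congr Num.sqrt; field; rewrite gt_eqF.
Qed.

(** A chord is compared with the areas of the strips of width 1 on its right,
    here, and on its left, in chord_step_le; these areas telescope in a sum. *)
Lemma chord_step_ge n i : (i < n)%N ->
  n%:R ^+ 2 * (circle_primitive (i.+1%:R / n%:R) -
    circle_primitive (i%:R / n%:R)) <= chord n i.
Proof.
move=> i_n; have n0 : (0 < n)%N by apply: leq_ltn_trans i_n.
have n0' : 0 < n%:R :> R by rewrite ltr0n.
rewrite chordE //.
have := @circle_primitive_le R (i%:R / n%:R) (i.+1%:R / n%:R).
have -> : i.+1%:R / n%:R - i%:R / n%:R = n%:R^-1 :> R.
  by rewrite -mulrBl -natrB // subSnn mul1r.
move=> /(_ _ _ _)/(ler_wpM2l (sqr_ge0 n%:R)).
rewrite expr2 mulrA -(mulrA n%:R n%:R n%:R^-1) divff ?gt_eqF // mulr1.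
apply.
- by rewrite divr_ge0.
- by rewrite ler_pM2r ?invr_gt0 // ler_nat.
- by rewrite ler_pdivrMr // mul1r ler_nat.
Qed.

Lemma chord_step_le n i : (i < n)%N ->
  chord n i.+1 <= n%:R ^+ 2 * (circle_primitive (i.+1%:R / n%:R) -
    circle_primitive (i%:R / n%:R)).
Proof.
move=> i_n; have n0 : (0 < n)%N by apply: leq_ltn_trans i_n.
have n0' : 0 < n%:R :> R by rewrite ltr0n.
rewrite chordE //.
have := @circle_primitive_ge R (i%:R / n%:R) (i.+1%:R / n%:R).
have -> : i.+1%:R / n%:R - i%:R / n%:R = n%:R^-1 :> R.
  by rewrite -mulrBl -natrB // subSnn mul1r.
move=> /(_ _ _ _)/(ler_wpM2l (sqr_ge0 n%:R)).
rewrite {1}expr2 mulrA -(mulrA n%:R n%:R n%:R^-1) divff ?gt_eqF // mulr1.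
apply.
- by rewrite divr_ge0.
- by rewrite ler_pM2r ?invr_gt0 // ler_nat.
- by rewrite ler_pdivrMr // mul1r ler_nat.
Qed.

Lemma sum_chord_ge n : (0 < n)%N ->
  pi / 4 * n%:R ^+ 2 <= \sum_(i < n.+1) chord n i.
Proof.
move=> n0.
have H j : (j <= n)%N ->
    n%:R ^+ 2 * circle_primitive (j%:R / n%:R) <= \sum_(i < j) chord n i.
  elim: j => [|j IH] jn; first by rewrite mul0r circle_primitive0 mulr0 big_ord0.
  rewrite big_ord_recr /=; have := IH (ltnW jn); have := chord_step_ge jn; lra.
rewrite big_ord_recr /= mulrC; have := H n (leqnn n).
rewrite divff ?circle_primitive1 ?pnatr_eq0 -?lt0n //.
have : 0 <= chord n n by apply: sqrtr_ge0.
lra.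
Qed.

Lemma count_le_ge (r : R) (M : nat) : r <= M%:R ->
  r <= \sum_(k < M) (k%:R <= r)%R%:R.
Proof.
elim: M => [|M IH] rM; first by rewrite big_ord0.
rewrite big_ord_recr /=; have [h|h] := leP r M%:R.
  by rewrite -[leLHS]addr0 lerD ?IH //.
rewrite (ltW h) (eq_bigr (fun=> 1)) => [|i _]; last first.
  by rewrite (le_trans _ (ltW h)) // ler_nat ltnW.
by rewrite sumr_const card_ord -[X in r <= _ + X]/(1%:R) -natrD addn1.
Qed.

Lemma count_between_le (l r : R) (M : nat) : l <= r + 1 ->
  \sum_(k < M) (l <= k%:R <= r)%R%:R <= r - l + 1.
Proof.
elim: M r => [|M IH] r lr; first by rewrite big_ord0; lra.
rewrite big_ord_recr /=; have [h|h] := ltP r M%:R.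
  by rewrite andbF addr0 IH.
rewrite andbT; have [h'|h'] := leP l M%:R.
  apply: (@le_trans _ _ (M%:R - l + 1)); last lra.
  rewrite lerD2r; have := IH (M%:R - 1); rewrite subrK => /(_ h').
  have -> : M%:R - 1 - l + 1 = M%:R - l by ring.
  move=> IH'; apply: (le_trans _ IH'); apply: ler_sum => k _; rewrite ler_nat.
  have km : k%:R <= M%:R - 1 :> R.
    by rewrite lerBrDr -[X in _ + X]/(1%:R) -natrD addn1 ler_nat ltn_ord.
  by rewrite km andbT; case: (l <= k%:R)%R; rewrite ?leq_b1.
rewrite addr0 big1 => [|k _]; first lra.
case: leP => //= lk.
have : k%:R <= M%:R :> R by rewrite ler_nat ltnW.
lra.
Qed.

(** Natural coordinates suffice: up to the symmetry x |-> - x, both exceptional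
    sectors are covered by these columns. *)
Definition column_count (m n i : nat) : nat :=
  \sum_(k < n.+1) ((m * i <= k) && (i ^ 2 + k ^ 2 <= n ^ 2))%N.

Lemma column_countE m n i :
  (column_count m n i)%:R =
  \sum_(k < n.+1) ((m%:R * i%:R <= k%:R :> R)%R && (k%:R <= chord n i)%R && (i <= n)%N)%:R :> R.
Proof.
rewrite /column_count natr_sum; apply: eq_bigr => k _.
rewrite -andbA -natrM (ler_nat R); congr (nat_of_bool (_ && _))%:R.
apply/idP/andP => [h|[h1 h2]].
  have i_n : (i <= n)%N by nia.
  split=> //; rewrite -[leLHS]ger0_norm // -sqrtr_sqr ler_wsqrtr //.
  by rewrite lerBrDl -!natrX -natrD ler_nat.
have : k%:R ^+ 2 <= chord n i ^+ 2 by rewrite lerXn2r ?nnegrE ?sqrtr_ge0.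
rewrite sqr_sqrtr; last by rewrite subr_ge0 -!natrX ler_nat leq_exp2r.
by rewrite lerBrDl -!natrX -natrD ler_nat.
Qed.

Lemma column_count_le m n i : m%:R * i%:R <= chord n i + 1 ->
  (column_count m n i)%:R <= chord n i - m%:R * i%:R + 1.
Proof.
move=> h; rewrite column_countE; apply: le_trans (count_between_le n.+1 h).
by apply: ler_sum => k _; rewrite ler_nat; case: (_ <= _ <= _); case: (i <= n)%N.
Qed.

(** The sector between the vertical half-axis and the ray of slope m has opening
    theta, since tan theta = 1 / m, and area theta / 2 * n ^ 2. The columns of
    abscissa at most n sin theta are compared with the primitive G of
    sqrt (1 - t ^ 2) - m t, and the others are empty. *)
Lemma sum_column_count_le (m n : nat) (theta : R) : (0 < n)%N ->
  0 <= theta <= pi / 2 -> cos theta = m%:R * sin theta ->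
  (\sum_(i < n.+1) column_count m n i)%:R <=
    theta / 2 * n%:R ^+ 2 + 2 * (n%:R + 1).
Proof.
move=> n0 theta_pi ctheta.
have n0' : 0 < n%:R :> R by rewrite ltr0n.
have pi0 := pi_ge0 R.
pose c := sin theta.
have c0 : 0 <= c by apply: sin_ge0_pi; lra.
have c1 : c <= 1 by apply: sin_le1.
have cE : Num.sqrt (1 - c ^+ 2) = m%:R * c.
  rewrite -cos2sin2 sqrtr_sqr ger0_norm // cos_ge0_pihalf //; lra.
have asinc : asin c = theta by rewrite sinK // in_itv /=; lra.
pose G t : R := circle_primitive t - m%:R * t ^+ 2 / 2.
have Gc : G c = theta / 2.
  by rewrite /G /circle_primitive cE asinc; lra.
have in_sector i : i%:R / n%:R <= c -> m%:R * i%:R <= chord n i.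
  move=> ic; rewrite chordE //.
  have -> : m%:R * i%:R = n%:R * (m%:R * (i%:R / n%:R)) :> R by field; rewrite gt_eqF.
  rewrite ler_pM2l //; apply: (@le_trans _ _ (m%:R * c)); first by rewrite ler_wpM2l.
  rewrite -cE ler_wsqrtr // lerD2l lerN2.
  by rewrite lerXn2r ?nnegrE // divr_ge0.
have G_le i : i%:R / n%:R <= c -> G (i%:R / n%:R) <= theta / 2.
  move=> ic; rewrite -Gc /G.
  have := @circle_primitive_ge R (i%:R / n%:R) c.
  rewrite cE => /(_ _ ic c1)H.
  have {H} : (c - i%:R / n%:R) * (m%:R * c) <=
       circle_primitive c - circle_primitive (i%:R / n%:R).
    by apply: H; rewrite divr_ge0.
  have : 0 <= m%:R * (c - i%:R / n%:R) ^+ 2 by rewrite mulr_ge0 ?sqr_ge0.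
  lra.
have col0 : (column_count m n 0)%:R <= n%:R + 1 :> R.
  rewrite -[X in _ + X]/(1%:R) -natrD addn1 ler_nat /column_count.
  by rewrite -[leqRHS]card_ord -sum1_card leq_sum // => k _; case: (_ && _).
(* Column 0 has no strip on its left; it accounts for the n + 1. *)
have inside j : j%:R / n%:R <= c -> (\sum_(i < j.+1) column_count m n i)%:R <=
    n%:R + 1 + n%:R ^+ 2 * G (j%:R / n%:R) + j%:R.
  elim: j => [|j IH] jc.
    by rewrite big_ord1 /G mul0r circle_primitive0; lra.
  rewrite big_ord_recr /= natrD.
  have jc' : j%:R / n%:R <= c.
    by apply: le_trans jc; rewrite ler_pM2r ?invr_gt0 // ler_nat.
  have jn : (j < n)%N.
    have : j.+1%:R / n%:R <= 1 :> R by apply: le_trans c1.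
    by rewrite ler_pdivrMr // mul1r ler_nat.
  have h1 := IH jc'; have h2 := chord_step_le jn.
  have h3 : (column_count m n j.+1)%:R <= chord n j.+1 - m%:R * j.+1%:R + 1.
    by apply: column_count_le; have := in_sector _ jc; lra.
  have nG i : n%:R ^+ 2 * G (i%:R / n%:R) =
      n%:R ^+ 2 * circle_primitive (i%:R / n%:R) - m%:R * i%:R ^+ 2 / 2.
    by rewrite /G; field; rewrite gt_eqF.
  move: h1 h2 h3; rewrite !nG -(natr1 j).
  have : 0 <= m%:R :> R by [].
  lra.
have all j : (\sum_(i < j.+1) column_count m n i)%:R <=
    n%:R + 1 + n%:R ^+ 2 * (theta / 2) + j%:R.
  elim: j => [|j IH]; last first.
    have [jc|jc] := leP (j.+1%:R / n%:R) c.
      by apply: (le_trans (inside _ jc)); rewrite lerD2r lerD2l ler_wpM2l ?sqr_ge0 ?G_le.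
    rewrite big_ord_recr /= [column_count m n j.+1](_ : _ = 0%N).
      by rewrite addn0 -(natr1 j); lra.
    rewrite /column_count big1 // => k _; apply/eqP; rewrite eqb0.
    apply/negP => /andP[h1 h2].
    have h : ((1 + m%:R ^+ 2) * j.+1%:R ^+ 2 <= n%:R ^+ 2 :> R).
      rewrite -!natrX -[X in X + _]/(1%:R) -natrD -natrM ler_nat; nia.
    move: jc; apply/negP; rewrite -leNgt ler_pdivrMr //.
    rewrite -(@ler_pXn2r _ 2) ?nnegrE ?mulr_ge0 //.
    have m0 : 0 < 1 + m%:R ^+ 2 :> R by rewrite ltr_pwDl // sqr_ge0.
    rewrite -(ler_pM2l m0) (le_trans h) // exprMn mulrA.
    suff -> : (1 + m%:R ^+ 2) * c ^+ 2 = 1 by rewrite mul1r.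
    have := cos2sin2 theta; rewrite ctheta -/c; lra.
  have := inside 0%N; rewrite mul0r => /(_ c0).
  rewrite /G circle_primitive0 expr0n /=.
  have : 0 <= n%:R ^+ 2 * (theta / 2).
    by rewrite mulr_ge0 ?sqr_ge0 //; lra.
  lra.
have := all n; lra.
Qed.

End Sectors.

Local Open Scope classical_set_scope.

(** * Densities and sums over boxes *)

Section LimitBounds.
Variables (R : realType) (u : R^nat).
Hypothesis u01 : forall n, 0 <= u n <= 1.

Let u_bounded : bounded_fun u.
Proof.
exists 1; split; first exact: num_real.
by move=> x x1 n _; have /andP[? ?] := u01 n; rewrite /= ger0_norm // (le_trans _ (ltW x1)).
Qed.

Lemma limn_inf_ge_eventually (a : R) :
  (forall e, 0 < e -> exists N, forall n, (N <= n)%N -> a - e <= u n) ->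
  a <= limn_inf u.
Proof.
move=> H; apply/ler_addgt0Pr => e e0; have [N HN] := H e e0.
rewrite -lerBlDr (limn_infE u_bounded).
apply: (@le_trans _ _ (infs u N)).
  apply: lb_le_inf; first by exists (u N); exists N => /=.
  by move=> _ [n /= Nn <-]; exact: HN.
apply: ub_le_sup; last by exists N.
exact: bounded_fun_has_ubound_infs.
Qed.

Lemma limn_sup_le1 : limn_sup u <= 1.
Proof.
rewrite (limn_supE u_bounded); apply: (@le_trans _ _ (sups u 0%N)).
  apply: ge_inf; last by exists 0%N.
  exact: bounded_fun_has_lbound_sups.
apply: ge_sup; first by exists (u 0%N); exists 0%N.
by move=> _ [n _ <-]; have /andP[] := u01 n.
Qed.

Lemma limn_inf_le_limn_sup : limn_inf u <= limn_sup u.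
Proof.
rewrite (limn_infE u_bounded) (limn_supE u_bounded).
apply: ge_sup; first by exists (infs u 0%N); exists 0%N.
move=> _ [m _ <-]; apply: lb_le_inf; first by exists (sups u 0%N); exists 0%N.
move=> _ [k _ <-]; apply: (@le_trans _ _ (u (maxn m k))).
  apply: ge_inf; last by exists (maxn m k) => //=; exact: leq_maxl.
  exact/has_lbound_sdrop/bounded_fun_has_lbound.
apply: ub_le_sup; last by exists (maxn m k) => //=; exact: leq_maxr.
exact/has_ubound_sdrop/bounded_fun_has_ubound.
Qed.

End LimitBounds.

Section Box.
Variable R : realType.
Implicit Types (f : int -> R) (g : int * int -> R).

(** Summing f (Posz i) + f (Negz i) over i < M covers the half-open interval
    [- M, M), which is a union of full periods when the period divides M. *)
Definition boxsum1 (M : nat) f : R := \sum_(i < M) (f (Posz i) + f (Negz i)).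

Definition boxsum (M : nat) g : R :=
  boxsum1 M (fun a => boxsum1 M (fun c => g (a, c))).

Definition in_box (M : nat) (a : int) : bool := (- M%:Z <= a < M%:Z).

Lemma ler_boxsum1 M f f' : (forall a, in_box M a -> f a <= f' a) ->
  boxsum1 M f <= boxsum1 M f'.
Proof.
move=> h; apply: ler_sum => i _.
by apply: lerD; apply: h; rewrite /in_box; have := ltn_ord i; lia.
Qed.

Lemma ler_boxsum M g g' :
  (forall x, in_box M x.1 -> in_box M x.2 -> g x <= g' x) ->
  boxsum M g <= boxsum M g'.
Proof. by move=> h; apply: ler_boxsum1 => a aM; apply: ler_boxsum1 => c cM; apply: h. Qed.

Lemma boxsum1D M f f' : boxsum1 M (fun a => f a + f' a) = boxsum1 M f + boxsum1 M f'.
Proof.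
by rewrite /boxsum1 -big_split /=; apply: eq_bigr => i _; ring.
Qed.

Lemma boxsumD M g g' : boxsum M (fun x => g x + g' x) = boxsum M g + boxsum M g'.
Proof.
rewrite /boxsum -boxsum1D; apply: eq_bigr => i _.
by rewrite !boxsum1D.
Qed.

Definition box_point (M : nat) (t : bool * 'I_M) : int :=
  if t.1 then Posz t.2 else Negz t.2.

Lemma box_point_inj M : injective (@box_point M).
Proof.
move=> [[] i] [[] j]; rewrite /box_point //= => -[ij]; congr (_, _); exact: val_inj.
Qed.

Lemma box_pointP M a : in_box M a -> exists t, a = @box_point M t.
Proof.
rewrite /in_box; case: a => n; rewrite ?NegzE => h.
  have nM : (n < M)%N by lia.
  by exists (true, Ordinal nM).
have nM : (n < M)%N by lia.
by exists (false, Ordinal nM); rewrite /box_point /= NegzE.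
Qed.

Lemma boxsum1E M f : boxsum1 M f = \sum_(t : bool * 'I_M) f (box_point t).
Proof.
rewrite -(pair_bigA _ (fun b i => f (@box_point M (b, i)))) /= big_bool /=.
by rewrite -big_split.
Qed.

Lemma card_fset_set_boxsum M (A : set (int * int)) :
  (forall x, A x -> in_box M x.1 && in_box M x.2) ->
  #|` fset_set A|%:R = boxsum M (fun x => `[< A x >]%:R).
Proof.
move=> AM.
pose h (t : (bool * 'I_M) * (bool * 'I_M)) := (box_point t.1, box_point t.2).
have h_inj : injective h.
  by move=> [? ?] [? ?] [/box_point_inj -> /box_point_inj ->].
have AE : A = [set` [fset h t | t in [pred t | `[< A (h t) >]]]%fset].
  apply/seteqP; split=> x /=.
    move=> Ax; have /andP[/box_pointP[t1 e1] /box_pointP[t2 e2]] := AM _ Ax.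
    have xE : x = h (t1, t2) by rewrite /h /= -e1 -e2; case: (x).
    apply/imfsetP; exists (t1, t2) => //=; rewrite inE -xE; exact: Ax.
  by move=> /imfsetP[t /=]; rewrite inE => At ->.
rewrite {1}AE set_fsetK card_imfset //=.
rewrite /boxsum boxsum1E.
under eq_bigr do rewrite boxsum1E.
rewrite pair_bigA /=.
rewrite -natr_sum; congr (_%:R).
rewrite -cardE -sum1_card big_mkcond /=; apply: eq_bigr => t _.
by rewrite unfold_in /=; case: `[< _ >].
Qed.

Lemma lattice_discE n (x : int * int) :
  lattice_disc (n%:R : R) x <-> x.1 ^+ 2 + x.2 ^+ 2 <= n%:Z ^+ 2.
Proof.
rewrite /lattice_disc /euclidean_norm /= -(ler_int R) rmorphD !rmorphXn /=.
rewrite -[X in _ <= X]ger0_norm // -sqrtr_sqr ler_sqrt ?sqr_ge0 //.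
Qed.

Lemma lattice_disc_in_box n (x : int * int) :
  lattice_disc (n%:R : R) x -> in_box n.+1 x.1 && in_box n.+1 x.2.
Proof. by move=> /lattice_discE; rewrite /in_box; nia. Qed.

(** The box may be any one that contains the disc: the smallest is used to count
    columns, and one made of full periods to count residue classes. *)
Lemma disc_count_boxsum Z n M : (n < M)%N ->
  (disc_count Z (n%:R : R))%:R =
  boxsum M (fun x => `[< Z x /\ lattice_disc (n%:R : R) x >]%:R).
Proof.
move=> nM; apply: card_fset_set_boxsum => x [_ /lattice_disc_in_box].
by rewrite /in_box; lia.
Qed.

Lemma disc_countC Z n :
  disc_count Z (n%:R : R) + disc_count (~` Z) (n%:R : R) =
  disc_count setT (n%:R : R) :> nat.
Proof.
apply/eqP; rewrite -(eqr_nat R) natrD !(disc_count_boxsum _ (ltnSn n)) -boxsumD; apply/eqP.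
congr boxsum; apply/funext => x /=; rewrite -natrD; congr (_%:R).
have [Dx|Dx] := pselect (lattice_disc (n%:R : R) x); last first.
  by rewrite !asboolF // => -[].
have [Zx|Zx] := pselect (Z x).
  by rewrite asboolT // asboolF ?asboolT // => -[].
by rewrite asboolF ?asboolT // => -[].
Qed.

Lemma disc_count_setT_gt0 n : (0 < disc_count setT (n%:R : R))%N.
Proof.
rewrite cardfs_gt0; apply/fset0Pn; exists (0, 0).
rewrite in_fset_set; last exact/finite_setIr/finite_lattice_disc.
by rewrite inE; split=> //; apply/lattice_discE; rewrite /=; lia.
Qed.

(** The four quarter discs contribute 4 times the sum of the chords, and rounding
    costs O(n). *)
Lemma disc_count_setT_ge n : (0 < n)%N ->
  (pi : R) * n%:R ^+ 2 - 6 * (n%:R + 1) <= (disc_count setT (n%:R : R))%:R.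
Proof.
move=> n0; rewrite (disc_count_boxsum _ (ltnSn n)).
have chord_le i : (i <= n)%N -> chord R n i <= n.+1%:R.
  move=> i_n; rewrite -[leRHS]ger0_norm // -sqrtr_sqr ler_wsqrtr //.
  rewrite lerBlDr ler_wpDr ?sqr_ge0 // lerXn2r ?nnegrE // ler_nat; lia.
have chord_disc (a c : int) (i k : nat) : `|a|%N = i -> `|c|%N = k ->
    (i <= n)%N ->
    (k%:R <= chord R n i)%R%:R <= `[< setT (a, c) /\ lattice_disc (n%:R : R) (a, c) >]%:R :> R.
  move=> ai ck i_n; rewrite ler_nat; case: leP => //= h.
  rewrite asboolT //; split=> //; apply/lattice_discE => /=.
  have : k%:R ^+ 2 <= chord R n i ^+ 2 by rewrite lerXn2r ?nnegrE ?sqrtr_ge0.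
  rewrite sqr_sqrtr; last by rewrite subr_ge0 -!natrX ler_nat leq_exp2r.
  by rewrite lerBrDl -!natrX -natrD ler_nat; nia.
have row (a : int) : (`|a| <= n)%N -> 2 * chord R n `|a| - 1 <=
    boxsum1 n.+1 (fun c => `[< setT (a, c) /\ lattice_disc (n%:R : R) (a, c) >]%:R).
  move=> an; rewrite /boxsum1 big_split /=.
  have h1 := count_le_ge (chord_le _ an).
  have h2 : chord R n `|a| - 1 <=
    \sum_(k < n.+1) (k.+1%:R <= chord R n `|a|)%R%:R.
    have := @count_le_ge R (chord R n `|a| - 1) n.+1; rewrite lerBlDr.
    move=> /(_ (ler_wpDr _ (chord_le _ an))) => /(_ ler01) /le_trans; apply.
    by apply: ler_sum => k _; rewrite lerBrDr natr1.
  apply: le_trans (lerD (le_trans h1 _) (le_trans h2 _)); first last.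
  - by apply: ler_sum => k _; apply: chord_disc => //; lia.
  - by apply: ler_sum => k _; apply: chord_disc => //; lia.
  - by lra.
have h3 := @sum_chord_ge R n n0.
pose D a c : R := `[< setT (a, c) /\ lattice_disc (n%:R : R) (a, c) >]%:R.
rewrite /boxsum {1}/boxsum1 big_split /=.
have h4 : \sum_(i < n.+1) (2 * chord R n i - 1) <=
    \sum_(i < n.+1) boxsum1 n.+1 (D i%:Z).
  by apply: ler_sum => i _; apply: (row i%:Z); rewrite -ltnS; exact: ltn_ord.
have h5 : \sum_(i < n) (2 * chord R n i.+1 - 1) <=
    \sum_(i < n.+1) boxsum1 n.+1 (D (Negz i)).
  rewrite big_ord_recr /= -[leLHS]addr0; apply: lerD.
    by apply: ler_sum => i _; apply: (row (Negz i)); exact: ltn_ord.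
  by apply: sumr_ge0 => k _; rewrite addr_ge0.
apply: le_trans (lerD h4 h5).
rewrite !big_split /= -!mulr_sumr !sumr_const !card_ord.
have h6 : \sum_(i < n.+1) chord R n i = chord R n 0%N + \sum_(i < n) chord R n i.+1.
  by rewrite big_ord_recl.
have c0 := chord_le 0%N isT.
move: h3 c0; rewrite h6 -(natr1 n) !mulNrn -(natr1 n).
set S := \sum_(i < n) _; set c := chord R n _; move: S c => S c.
have := ler0n R n; move: (n%:R : R) (pi : R) => x p; lra.
Qed.

Lemma disc_ratio_bounds Z n : 0 <= disc_ratio R Z n <= 1.
Proof.
rewrite /disc_ratio divr_ge0 //= ler_pdivrMr ?ltr0n ?disc_count_setT_gt0 //.
by rewrite mul1r ler_nat -(disc_countC Z n) leq_addr.
Qed.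

Lemma upper_density_le1 Z : upper_density R Z <= 1.
Proof. exact/limn_sup_le1/disc_ratio_bounds. Qed.

Lemma lower_density_le_upper Z : lower_density R Z <= upper_density R Z.
Proof. exact/limn_inf_le_limn_sup/disc_ratio_bounds. Qed.

(** Densities are bounded through the complement, which is where the upper
    estimates on counts apply; the O(n) term is absorbed because the disc contains
    about pi n ^ 2 points. *)
Lemma lower_density_ge Z (kappa K : R) : 0 <= kappa ->
  (forall n, (0 < n)%N -> (disc_count (~` Z) (n%:R : R))%:R <=
     kappa * n%:R ^+ 2 + K * (n%:R + 1)) ->
  1 - pi^-1 * kappa <= lower_density R Z.
Proof.
move=> k0 H; apply: limn_inf_ge_eventually; first exact: disc_ratio_bounds.
move=> e e0.
have pi0 := pi_gt0 R.
pose q := pi^-1 * kappa + e.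
have q0 : 0 < q by rewrite ltr_wpDl // mulr_ge0 // invr_ge0 ltW.
(* The O(n) terms amount to at most 2 (|K| + 6 q) n, to be beaten by e pi n ^ 2. *)
pose B := 2 * (`|K| + 6 * q) / (e * pi).
exists (Num.bound B).+1 => n nB.
have n0 : (0 < n)%N by apply: leq_trans nB.
have n1 : 1 <= n%:R :> R by rewrite ler1n.
have Bn : B <= n%:R.
  apply: (@le_trans _ _ (Num.bound B)%:R); last by rewrite ler_nat ltnW.
  apply/ltW/archi_boundP; rewrite /B divr_ge0 //; last by rewrite mulr_ge0 ?ltW.
  by rewrite mulr_ge0 // addr_ge0 // mulr_ge0 // ltW.
pose tau : R := (disc_count setT (n%:R : R))%:R.
pose mu : R := (disc_count (~` Z) (n%:R : R))%:R.
have tau0 : 0 < tau by rewrite ltr0n disc_count_setT_gt0.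
have ratioE : disc_ratio R Z n = 1 - mu / tau.
  rewrite /disc_ratio -/tau -[X in X - _](divff (lt0r_neq0 tau0)) -mulrBl; congr (_ / _).
  by rewrite /tau -(disc_countC Z n) natrD addrK.
rewrite ratioE -addrA -opprD lerD2l lerN2 ler_pdivrMr //.
have h1 := H n n0; have h2 := disc_count_setT_ge n0.
apply: (le_trans h1); rewrite -/q.
apply: (@le_trans _ _ (q * (pi * n%:R ^+ 2 - 6 * (n%:R + 1)))); last first.
  by rewrite ler_pM2l.
have qpi : q * pi = kappa + e * pi.
  by rewrite /q mulrDl mulrAC mulVf ?mul1r // lt0r_neq0.
have : 2 * (`|K| + 6 * q) <= e * pi * n%:R.
  by move: Bn; rewrite /B ler_pdivrMr ?mulr_gt0 // [n%:R * _]mulrC.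
move/(ler_wpM2r (ler0n R n)).
have K1 : K * (n%:R + 1) <= `|K| * (2 * n%:R).
  apply: (@le_trans _ _ (`|K| * (n%:R + 1))).
    by rewrite ler_wpM2r ?ler_norm //; lra.
  by rewrite ler_wpM2l //; lra.
have q1 : q * (n%:R + 1) <= q * (2 * n%:R) by rewrite ler_pM2l //; lra.
have -> : q * (pi * n%:R ^+ 2 - 6 * (n%:R + 1)) =
  (kappa + e * pi) * n%:R ^+ 2 - 6 * (q * (n%:R + 1)) by rewrite -qpi; ring.
lra.
Qed.

End Box.

(** * Lower density of the divergent set *)

Lemma atan_le_id (R : realType) (x : R) : 0 <= x -> atan x <= x.
Proof.
move=> x0; rewrite -subr_ge0.
have := @derive_ge0_le R (fun x => x - atan x) (fun x => 1 - (1 + x ^+ 2)^-1) 0 x.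
rewrite atan0 subrr; apply => // y _.
have y0 : 0 < 1 + y ^+ 2 by rewrite ltr_pwDl ?sqr_ge0.
by rewrite subr_ge0 invf_le1 // lerDl sqr_ge0.
Qed.

Lemma acos_atan (R : realType) (x : R) : 0 < x ->
  acos (1 / Num.sqrt (1 + x ^- 2)) = atan x^-1.
Proof.
move=> x0; rewrite div1r -exprVn -cos_atan cosK // in_itv /=.
have := @le_atan R 0 x^-1; rewrite atan0 invr_ge0 => /(_ (ltW x0)) ->.
have := atan_ltpi2 x^-1; have := pi_ge0 R; lra.
Qed.

Section DivDensity.
Variables (R : realType) (b d : int).
Hypotheses (d2 : 2 <= d) (b1 : 1 <= b).

(** Outside the two divergence cones lie two opposite sectors, between the line
    x2 = b d x1 and the vertical axis. In the one with x1 < 0, column - (i + 1) is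
    shifted onto column i, which is at least as long. *)
Lemma notDiv_count_le m n : b * d = m%:Z ->
  (disc_count (~` Div (Tmap b d)) (n%:R : R) <=
    2 * \sum_(i < n.+1) column_count m n i)%N.
Proof.
move=> bd_m; rewrite -(ler_nat R) (disc_count_boxsum R _ (ltnSn n)).
have m0 : (0 < m)%N by nia.
pose D a c : R :=
  `[< (~` Div (Tmap b d)) (a, c) /\ lattice_disc (n%:R : R) (a, c) >]%:R.
have D0 a c : ~ (0 <= a /\ b * d * a <= c \/ a <= -1 /\ c < b * d * a) ->
    D a c <= 0%:R.
  move=> h; rewrite /D asboolF // => -[nDiv _]; apply: h.
  have := @Div_cone b d (a, c) d2; rewrite /height /= => h.
  have [a0|a0] := leP 0 a.
    left; split=> //; have [//|lt] := leP (b * d * a) c.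
    by case: nDiv; apply: h; left; split=> //; lia.
  right; split; first lia.
  have [le|//] := leP (b * d * a) c.
  by case: nDiv; apply: h; right; split=> //; lia.
have Dle a c (P : bool) : (0 <= a /\ b * d * a <= c \/ a <= -1 /\ c < b * d * a ->
     a ^+ 2 + c ^+ 2 <= n%:Z ^+ 2 -> P) -> D a c <= P%:R.
  move=> hP; have [/hP h|/D0 h] := pselect (0 <= a /\ b * d * a <= c \/ a <= -1 /\ c < b * d * a); last first.
    by apply: (le_trans h); rewrite ler_nat.
  rewrite /D ler_nat; have [[_ /lattice_discE hd]|] := asboolP; last by [].
  by rewrite h.
have cols : \sum_(i < n.+1) (boxsum1 n.+1 (D i%:Z) + boxsum1 n.+1 (D (Negz i))) <=
    \sum_(i < n.+1) ((column_count m n i)%:R + (column_count m n i)%:R) :> R.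
  apply: ler_sum => i _; apply: lerD; rewrite /column_count natr_sum; apply: ler_sum => k _.
    rewrite -[leRHS]addr0; apply: lerD.
      apply: Dle => h1 h2; rewrite bd_m in h1; apply/andP; split; nia.
    by apply: D0; rewrite bd_m; nia.
  rewrite -[leRHS]add0r; apply: lerD.
    by apply: D0; rewrite bd_m; nia.
  apply: Dle; rewrite bd_m !NegzE => h1 h2; apply/andP; split; nia.
apply: (le_trans cols); rewrite big_split /= -natr_sum.
by rewrite natrM mulr_natl mulr2n.
Qed.

Lemma lower_density_Div_ge :
  1 - pi^-1 * acos (1 / Num.sqrt (1 + ((b * d)%:~R : R) ^- 2))
    <= lower_density R (Div (Tmap b d)).
Proof.
have [m bd_m] : exists m : nat, b * d = m%:Z by exists (absz (b * d)); nia.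
have m0 : (0 < m)%N by nia.
have m0R : 0 < m%:R :> R by rewrite ltr0n.
rewrite bd_m -[m%:Z%:~R]/(m%:R) acos_atan //.
have t0 : 0 <= atan (m%:R^-1 : R).
  by rewrite -[leLHS](@atan0 R) le_atan // invr_ge0 ltW.
apply: (@lower_density_ge R _ _ 4) => // n n0.
have := notDiv_count_le n bd_m; rewrite -(ler_nat R) => /le_trans; apply.
have := @sum_column_count_le R m n (atan m%:R^-1) n0.
rewrite t0 (ltW (atan_ltpi2 _)) => /(_ isT).
have : cos (atan m%:R^-1) = m%:R * sin (atan m%:R^-1) :> R.
  have c0 : 0 < cos (atan (m%:R^-1 : R)).
    by apply: cos_gt0_pihalf; rewrite atan_gtNpi2 atan_ltpi2.
  have := atanK (m%:R^-1 : R); rewrite /tan => h.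
  have -> : sin (atan (m%:R^-1 : R)) = m%:R^-1 * cos (atan m%:R^-1).
    by rewrite -[X in X * cos _]h mulfVK ?gt_eqF.
  by rewrite mulrA divff ?mul1r ?gt_eqF.
move=> /[swap] /[apply]; rewrite natrM; lra.
Qed.
End DivDensity.

Lemma lower_density_le1 (R : realType) Z : lower_density R Z <= 1.
Proof. exact: le_trans (lower_density_le_upper _ _) (upper_density_le1 _ _). Qed.

Lemma lower_density_Div_near1 (R : realType) (eps : R) : 0 < eps ->
  exists N : int, forall d b : int, 2 <= d -> 1 <= b -> N <= b * d ->
    `|lower_density R (Div (Tmap b d)) - 1| < eps.
Proof.
move=> e0; exists (Num.bound eps^-1).+1%:Z => d b d2 b1 Nbd.
have bd0 : 0 < (b * d)%:~R :> R by rewrite ltr0z; nia.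
have := lower_density_Div_ge R d2 b1; rewrite acos_atan //.
have := lower_density_le1 R (Div (Tmap b d)).
have := @atan_le_id R (b * d)%:~R^-1; rewrite invr_ge0 => /(_ (ltW bd0)).
set x := _^-1 => h1 h2 h3.
have xe : x < eps.
  rewrite /x invf_plt ?posrE //.
  apply: (lt_le_trans (archi_boundP _)); first by rewrite invr_ge0 ltW.
  rewrite -[_%:R]/(Posz _)%:~R ler_int.
  by apply: le_trans Nbd; rewrite lez_nat.
have p1 : pi^-1 * atan x <= x :> R.
  apply: le_trans h1; rewrite ler_piMl //.
    by rewrite -[leLHS](@atan0 R) le_atan // invr_ge0 ltW.
  by rewrite invf_le1 ?pi_gt0 //; have := pi_ge2 R; lra.
rewrite ltr_norml; apply/andP; split; lra.
Qed.

(** * Sums of periodic functions *)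

Section PeriodicSums.
Variable R : realType.
Implicit Types (f : int -> R) (g : int * int -> R) (N L : nat).

Lemma sum_ord_mul (F : nat -> R) n k :
  \sum_(i < n * k) F i = \sum_(i < n) \sum_(j < k) F (i * k + j)%N.
Proof.
rewrite -(big_mkord xpredT F) big_nat_mul big_mkord; apply: eq_bigr => i _.
rewrite mulSn addnC -{1}[(i * k)%N]add0n big_addn addKn big_mkord.
by apply: eq_bigr => j _; rewrite addnC.
Qed.

Definition periodic1 N f := forall a z, f (a + N%:Z * z) = f a.

(** An affine map with multiplier prime to N permutes the residues modulo N. *)
Lemma sum_affine N f (u v : int) : periodic1 N f -> coprimez u N ->
  \sum_(i < N) f (u * i%:Z + v) = \sum_(i < N) f i%:Z.
Proof.
case: N => [|N] fN uN; first by rewrite !big_ord0.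
have lt (i : 'I_N.+1) : (`|((u * i%:Z + v) %% N.+1%:Z)%Z| < N.+1)%N.
  have : 0 <= ((u * i%:Z + v) %% N.+1%:Z)%Z by apply: modz_ge0.
  have : ((u * i%:Z + v) %% N.+1%:Z)%Z < N.+1%:Z by apply: ltz_pmod.
  lia.
pose h i := Ordinal (lt i).
have hE i : (h i)%:Z = ((u * i%:Z + v) %% N.+1%:Z)%Z.
  by rewrite /= gez0_abs // modz_ge0.
have h_inj : injective h.
  move=> i j /(congr1 (fun i : 'I__ => i%:Z)); rewrite !hE => /eqP.
  rewrite eqz_mod_dvd opprD addrACA subrr addr0 -mulrBr.
  rewrite Gauss_dvdzr; last by rewrite coprimez_sym.
  case/dvdzP=> q qE; apply: val_inj => /=.
  move: (nat_of_ord i) (nat_of_ord j) (ltn_ord i) (ltn_ord j) qE => a c aN cN qE.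
  have [q1|[q0|q1]] : q <= -1 \/ q = 0 \/ 1 <= q by lia.
  - have : q * N.+1%:Z <= -1 * N.+1%:Z by rewrite ler_wpM2r.
    by rewrite -qE; lia.
  - by move: qE; rewrite q0 mul0r; lia.
  - have : 1 * N.+1%:Z <= q * N.+1%:Z by rewrite ler_wpM2r.
    by rewrite -qE; lia.
rewrite [RHS](reindex_inj h_inj); apply: eq_bigr => i _.
rewrite hE -[RHS](fN _ ((u * i%:Z + v) %/ N.+1%:Z)%Z); congr f.
by rewrite [RHS]addrC [_ * (_ %/ _)%Z]mulrC -divz_eq.
Qed.

Lemma sum_periodic N L f (u v : int) : periodic1 N f -> coprimez u N ->
  \sum_(i < L * N) f (u * i%:Z + v) = L%:R * \sum_(i < N) f i%:Z.
Proof.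
move=> fN uN; rewrite (sum_ord_mul (fun i => f (u * i%:Z + v))).
rewrite -[L in RHS]card_ord -sum1_card natr_sum mulr_suml; apply: eq_bigr => l _.
rewrite mul1r -(sum_affine v fN uN); apply: eq_bigr => j _.
rewrite -[RHS](fN _ (u * l%:Z)); congr f; rewrite PoszD PoszM; ring.
Qed.

Lemma boxsum1_periodic N L f : periodic1 N f ->
  boxsum1 (L * N) f = (2 * L)%:R * \sum_(i < N) f i%:Z.
Proof.
move=> fN; rewrite /boxsum1 big_split /=.
have c1 : coprimez 1 N by rewrite coprimezE coprime1n.
have cN1 : coprimez (-1) N by rewrite coprimezE coprime1n.
have <- : \sum_(i < L * N) f (1 * i%:Z + 0) = \sum_(i < L * N) f (Posz i).
  by apply: eq_bigr => i _; rewrite mul1r addr0.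
have <- : \sum_(i < L * N) f (-1 * i%:Z + -1) = \sum_(i < L * N) f (Negz i).
  by apply: eq_bigr => i _; congr f; rewrite NegzE; lia.
by rewrite !sum_periodic // natrM; ring.
Qed.

Lemma boxsum_periodic N L g :
  (forall x a b, g (x.1 + N%:Z * a, x.2 + N%:Z * b) = g x) ->
  boxsum (L * N) g =
  (2 * L)%:R ^+ 2 * \sum_(i < N) \sum_(j < N) g (i%:Z, j%:Z).
Proof.
move=> gN; have g1 a : periodic1 N (fun c => g (a, c)).
  by move=> c z; rewrite -[RHS](gN _ 0 z) /= mulr0 addr0.
rewrite /boxsum; have -> : (fun a => boxsum1 (L * N) (fun c => g (a, c))) =
    (fun a => (2 * L)%:R * \sum_(j < N) g (a, j%:Z)).
  by apply/funext => a; rewrite boxsum1_periodic.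
rewrite boxsum1_periodic => [|a z]; last first.
  by congr (_ * _); apply: eq_bigr => j _; rewrite -[RHS](gN _ z 0) /= mulr0 addr0.
by rewrite -mulr_sumr mulrA expr2.
Qed.

Lemma boxsum1Z M (k : R) f : boxsum1 M (fun a => k * f a) = k * boxsum1 M f.
Proof. by rewrite /boxsum1 mulr_sumr; apply: eq_bigr => i _; ring. Qed.

Lemma boxsum_small_le M (r : nat) :
  boxsum M (fun x => ((`|x.1| <= r)%N && (`|x.2| <= r)%N)%:R : R) <=
    (2 * (r%:R + 1)) ^+ 2.
Proof.
have h : boxsum1 M (fun a => (`|a| <= r)%N%:R : R) <= 2 * (r%:R + 1).
  rewrite /boxsum1.
  have := @count_between_le R 0 r%:R M; rewrite subr0 => /(_ _) h.
  have {}h : \sum_(k < M) (0 <= (k%:R : R) <= r%:R)%R%:R <= r%:R + 1 :> R.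
    by apply: h; rewrite addr_ge0.
  apply: (@le_trans _ _ (\sum_(k < M) (2 * (0 <= (k%:R : R) <= r%:R)%R%:R))); last first.
    by rewrite -mulr_sumr ler_wpM2l.
  apply: ler_sum => k _; rewrite ler0n /= ler_nat mulr_natl mulr2n.
  by apply: lerD; rewrite // ler_nat; lia.
rewrite /boxsum.
have -> : (fun a => boxsum1 M (fun c => ((`|(a, c).1| <= r)%N && (`|(a, c).2| <= r)%N)%:R : R))
   = (fun a => boxsum1 M (fun c => (`|c| <= r)%N%:R) * (`|a| <= r)%N%:R).
  apply/funext => a /=; rewrite mulrC -boxsum1Z; congr boxsum1; apply/funext => c.
  by rewrite -natrM mulnb.
have h0 : 0 <= boxsum1 M (fun a => (`|a| <= r)%N%:R : R).
  by apply: sumr_ge0 => i _; rewrite addr_ge0.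
by rewrite boxsum1Z expr2 ler_pM.
Qed.

End PeriodicSums.

(** * Iterates and products of multipliers *)

Definition mult (d : int) (x : int * int) : int := mcoef d (x.1 %% d)%Z (x.2 %% d)%Z.

Lemma mcoef_bounds (d i j : int) : 2 <= d -> 1 <= mcoef d i j <= d + 1.
Proof. by move=> d2; rewrite /mcoef; case: ifP => _; [|case: ifP => _]; lia. Qed.

Section MultiplierProducts.
Variables (b d : int).
Hypothesis d2 : 2 <= d.
Local Notation T := (Tmap b d).

Fixpoint mprod k (x : int * int) : int :=
  if k is k'.+1 then mult d x * mprod k' (T x) else 1.

Lemma mprod_ge1 k x : 1 <= mprod k x.
Proof.
elim: k x => [|k IH] x //=; have /andP[h _] := mcoef_bounds (x.1 %% d)%Z (x.2 %% d)%Z d2.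
by have := IH (T x); rewrite -/(mult d x) in h; nia.
Qed.

Lemma mprod_le k x : mprod k x <= (d + 1) ^+ k.
Proof.
elim: k x => [|k IH] x /=; first by rewrite expr0.
have /andP[h h'] := mcoef_bounds (x.1 %% d)%Z (x.2 %% d)%Z d2.
rewrite exprS ler_pM //; first by rewrite (le_trans _ h).
by apply: le_trans (mprod_ge1 _ _).
Qed.

Let modz_shift (a y : int) : ((a + d * y) %% d)%Z = (a %% d)%Z.
Proof. by rewrite addrC mulrC modzMDl. Qed.

Lemma mult_shift (x : int * int) (y z : int) : mult d (x.1 + d * y, x.2 + d * z) = mult d x.
Proof. by rewrite /mult /= !modz_shift. Qed.

(** Since T is affine on each residue class, the first k multipliers depend on x
    modulo d ^ k only. *)
Lemma Tmap_shift (x : int * int) (y z : int) : T (x.1 + d * y, x.2 + d * z) =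
  ((T x).1 + mult d x * y, (T x).2 + mult d x * z).
Proof.
have [e3 e4] := TmapE b x d2.
have := TmapE b (x.1 + d * y, x.2 + d * z) d2.
move: (T (_, _)) => t /=; rewrite !modz_shift -/(mult d x) => -[e1 e2].
have dI : injective ( *%R d) by apply: mulfI; lia.
by rewrite [LHS]surjective_pairing; congr (_, _); apply: dI;
  rewrite mulrDr ?e1 ?e2 ?e3 ?e4 -?/(mult d x); ring.
Qed.

Lemma mprod_periodic k (x : int * int) (y z : int) :
  mprod k (x.1 + d ^+ k * y, x.2 + d ^+ k * z) = mprod k x.
Proof.
elim: k x y z => [|k IH] x y z //=.
have E w : d ^+ k.+1 * w = d * (d ^+ k * w) by rewrite exprS mulrA.
rewrite !E mult_shift Tmap_shift.
have E' w : mult d x * (d ^+ k * w) = d ^+ k * (mult d x * w) by rewrite mulrCA.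
by rewrite !E' IH.
Qed.

Hypothesis b1 : 1 <= b.

Lemma rcoef_bounds (i j : int) : 0 <= i < d -> 0 <= j < d ->
  let M := b * d * d + (b + 2) * d + 1 in
  `|(rcoef b d i j).1| <= M /\ `|(rcoef b d i j).2| <= M.
Proof.
move=> /andP[i0 id] /andP[j0 jd] /=; rewrite /rcoef.
have h1 : 0 <= b * d * i <= b * d * d by nia.
have h2 : 0 <= b * d * (d - i) <= b * d * d by nia.
have h3 : 0 <= b * d by nia.
case: ifP => _ /=; first by rewrite normr0; split; nia.
case: ifP => _ /=; first by split; lia.
by case: ifP => _ /=; split; lia.
Qed.

(** The remainders r_(i,j) are bounded, so after k steps T acts as multiplication
    by mprod k x / d ^ k up to an error that does not depend on x. *)
Lemma iter_Tmap_approx k : exists2 C : int, 0 <= C & forall x,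
  `|d ^+ k * (iter k T x).1 - mprod k x * x.1| <= C /\
  `|d ^+ k * (iter k T x).2 - mprod k x * x.2| <= C.
Proof.
elim: k => [|k [C C0 IH]].
  by exists 0 => // x; rewrite /= expr0 !mul1r !subrr normr0.
pose M := b * d * d + (b + 2) * d + 1.
have M0 : 0 <= M by rewrite /M; nia.
have P0 : 0 <= (d + 1) ^+ k by rewrite exprn_ge0; lia.
exists (d * C + (d + 1) ^+ k * M); first by rewrite addr_ge0 ?mulr_ge0 //; lia.
move=> x; have [e1 e2] := TmapE b x d2.
rewrite -!/(mult d x) in e1 e2.
have [r1 r2] : `|(rcoef b d (x.1 %% d)%Z (x.2 %% d)%Z).1| <= M /\
               `|(rcoef b d (x.1 %% d)%Z (x.2 %% d)%Z).2| <= M.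
  apply: rcoef_bounds; rewrite modz_ge0 ?ltz_pmod //; lia.
have [h1 h2] := IH (T x).
have bound (t X p x' r : int) : d * x' = mult d x * X + r -> `|r| <= M ->
    `|d ^+ k * t - p * x'| <= C -> 0 <= p <= (d + 1) ^+ k ->
    `|d ^+ k.+1 * t - mult d x * p * X| <= d * C + (d + 1) ^+ k * M.
  move=> xE rM hC /andP[p0 pP].
  have -> : d ^+ k.+1 * t - mult d x * p * X = d * (d ^+ k * t - p * x') + p * r.
    have -> : r = d * x' - mult d x * X by rewrite xE; ring.
    by rewrite exprS; ring.
  apply: (le_trans (ler_normD _ _)); rewrite !normrM.
  rewrite (ger0_norm p0) (ger0_norm (_ : 0 <= d)); last lia.
  by apply: lerD; [rewrite ler_wpM2l //; lia|rewrite ler_pM].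
have pk : 0 <= mprod k (T x) <= (d + 1) ^+ k.
  by rewrite mprod_le andbT; apply: le_trans (mprod_ge1 _ _).
by rewrite iterSr; split; [exact: bound e1 _ h1 _|exact: bound e2 _ h2 _].
Qed.

(** As the entries are integers, M < D gives (M + 1) ^ 2 <= D ^ 2; the gain
    (2 M + 1) X ^ 2 exceeds the error terms, at most 4 M C |X| + 2 C ^ 2, as soon
    as |X| > 2 C for the larger entry X. *)
Lemma contraction_sqr (u v X Y M D C : int) : 0 <= C -> 0 <= M -> M < D ->
  `|D * u - M * X| <= C -> `|D * v - M * Y| <= C ->
  2 * C < `|X| \/ 2 * C < `|Y| ->
  u ^+ 2 + v ^+ 2 < X ^+ 2 + Y ^+ 2.
Proof.
move=> C0 M0 MD hu hv big.
have D0 : 0 < D by lia.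
wlog XY : X Y u v hu hv big / `|Y| <= `|X|.
  move=> H; have [|/ltW] := leP `|Y| `|X|; first exact: H.
  by rewrite addrC [ltRHS]addrC; apply: H => //; case: big; [right|left].
have {}big : 2 * C < `|X| by case: big => // ?; lia.
have hsq (w Z : int) : `|Z| <= `|X| -> `|D * w - M * Z| <= C ->
    (D * w) ^+ 2 <= M ^+ 2 * Z ^+ 2 + 2 * M * C * `|X| + C ^+ 2.
  move=> ZX h.
  have hle : `|D * w| <= M * `|Z| + C.
    rewrite -[D * w](subrK (M * Z)) (le_trans (ler_normD _ _)) // addrC lerD //.
    by rewrite normrM (ger0_norm M0).
  have : `|D * w| ^+ 2 <= (M * `|Z| + C) ^+ 2.
    by rewrite lerXn2r ?nnegrE // addr_ge0 ?mulr_ge0.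
  rewrite real_normK ?num_real // => /le_trans; apply.
  have : 0 <= M * C * (`|X| - `|Z|) by rewrite !mulr_ge0 ?subr_ge0.
  by rewrite -[Z ^+ 2]real_normK ?num_real //; lia.
have h1 := hsq u X (lexx _) hu; have h2 := hsq v Y XY hv.
have DD : 0 < D ^+ 2 by rewrite exprn_gt0.
rewrite -(ltr_pM2l DD).
have hD : (M + 1) ^+ 2 * (X ^+ 2 + Y ^+ 2) <= D ^+ 2 * (X ^+ 2 + Y ^+ 2).
  by rewrite ler_wpM2r ?addr_ge0 ?sqr_ge0 // lerXn2r ?nnegrE //; lia.
have XX : X ^+ 2 = `|X| ^+ 2 by rewrite real_normK ?num_real.
have Y0 : 0 <= Y ^+ 2 by apply: sqr_ge0.
have MY : 0 <= M * Y ^+ 2 by apply: mulr_ge0.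
have hM : 0 <= M * `|X| * (`|X| - 2 * C) by rewrite !mulr_ge0 //; lia.
have hC : (2 * C) ^+ 2 < `|X| ^+ 2 by rewrite ltrXn2r ?nnegrE ?mulr_ge0 //; lia.
have CC : 0 <= C ^+ 2 by apply: sqr_ge0.
move: h1 h2 hD; rewrite XX !exprMn.
move: (Y ^+ 2) (`|X|) Y0 MY hM hC => y x Y0 MY hM hC h1 h2 hD.
lra.
Qed.

Lemma Stop_of_mprod (R : realType) k : (1 < k)%N -> exists c : nat, forall x,
  mprod k x < d ^+ k -> ~~ ((`|x.1| <= c)%N && (`|x.2| <= c)%N) -> Stop R T x.
Proof.
move=> k1; have [C C0 H] := iter_Tmap_approx k.
exists (absz (2 * C)) => x lt; rewrite negb_and -!ltnNge => big.
exists k => //.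
have {}big : 2 * C < `|x.1| \/ 2 * C < `|x.2|.
  by case/orP: big => h; [left|right]; lia.
have [h1 h2] := H x.
have M0 : 0 <= mprod k x by apply: le_trans (mprod_ge1 _ _).
have lt2 := contraction_sqr C0 M0 lt h1 h2 big.
have pos (u v : int) : 0 <= u ^+ 2 + v ^+ 2 by rewrite addr_ge0 ?sqr_ge0.
rewrite /euclidean_norm -!rmorphXn -!rmorphD /= ltr_sqrt ?ltr_int //.
by rewrite ltr0z; apply: le_lt_trans lt2; exact: pos.
Qed.

End MultiplierProducts.

(** * The mean multiplier *)

Section MeanMultiplier.
Variable R : realType.

Definition root_mult (D : nat) (a c : nat) : R :=
  Num.sqrt ((mcoef D%:Z a%:Z c%:Z)%:~R / D%:R).

(** Inclusion-exclusion over the residues d - 1 for the two coordinates, corrected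
    at the residue (0, 0). *)
Lemma mcoef_indicators (D a c : nat) : (1 < D)%N -> (a < D)%N -> (c < D)%N ->
  mcoef D%:Z a%:Z c%:Z = D%:Z - 1 + 2 * (a == D.-1)%:Z + 2 * (c == D.-1)%:Z
    - 2 * (a == D.-1)%:Z * (c == D.-1)%:Z
    - (D%:Z - 2) * (a == 0%N)%:Z * (c == 0%N)%:Z.
Proof.
move=> D1 aD cD; rewrite /mcoef.
have -> : ((a%:Z == 0) && (c%:Z == 0)) = ((a == 0%N) && (c == 0%N)) by lia.
have -> : (Num.max a%:Z c%:Z < D%:Z - 1) = ((a != D.-1) && (c != D.-1)) by lia.
case: (eqVneq a 0%N) => a0; case: (eqVneq c 0%N) => c0;
  case: (eqVneq a D.-1) => a1; case: (eqVneq c D.-1) => c1; rewrite /=; lia.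
Qed.

Lemma sum_mcoef (D : nat) : (1 < D)%N ->
  \sum_(a < D) \sum_(c < D) mcoef D%:Z a%:Z c%:Z =
    D%:Z ^+ 3 - D%:Z ^+ 2 + 3 * D%:Z.
Proof.
move=> D1.
have last : \sum_(a < D) (a == D.-1 :> nat)%:Z = 1.
  case: D D1 => // D _; rewrite big_ord_recr /= eqxx big1 ?add0r // => i _.
  by rewrite ltn_eqF.
have first : \sum_(a < D) (a == 0%N :> nat)%:Z = 1.
  by case: D D1 {last} => // D _; rewrite big_ord_recl big1 ?addr0.
transitivity (\sum_(a < D) (D%:Z * (D%:Z - 1 + 2 * (a == D.-1 :> nat)%:Z) + 2
    - 2 * (a == D.-1 :> nat)%:Z - (D%:Z - 2) * (a == 0%N :> nat)%:Z)).
  apply: eq_bigr => a _.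
  under eq_bigr do rewrite mcoef_indicators //.
  rewrite !big_split /= !sumrN -!mulr_sumr last first !sumr_const card_ord.
  lia.
rewrite !big_split /= !sumrN -!mulr_sumr big_split /= -!mulr_sumr last first !sumr_const card_ord.
lia.
Qed.

(** The mean of m / d over all residue classes is 1 - 1 / d + 3 / d ^ 2, which is
    at most 1 for d >= 3 but equals 1 for d = 3. The square roots make the
    inequality strict: sqrt t = (1 + t) / 2 - (1 - sqrt t) ^ 2 / 2, and the class
    of 0 has t = 1 / d <> 1. *)
Lemma sum_root_mult_lt (D : nat) : (2 < D)%N ->
  \sum_(a < D) \sum_(c < D) root_mult D a c < D%:R ^+ 2.
Proof.
move=> D2.
have D0 : 0 < D%:R :> R by rewrite ltr0n; lia.
pose t a c : R := (mcoef D%:Z a%:Z c%:Z)%:~R / D%:R.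
have dd2 : 2 <= D%:Z by lia.
pose gap a c := (1 - root_mult D a c) ^+ 2 / 2.
have gapE a c : root_mult D a c = (1 + t a c) / 2 - gap a c.
  have t0 : 0 <= t a c.
    by rewrite divr_ge0 // ler0z; have /andP[] := mcoef_bounds a%:Z c%:Z dd2; lia.
  have := sqr_sqrtr t0; rewrite -/(root_mult D a c) /gap; lra.
have gap0 a c : 0 <= gap a c by rewrite divr_ge0 ?sqr_ge0.
have gap00 : 0 < gap 0%N 0%N.
  have : root_mult D 0 0 < 1.
    rewrite /root_mult /mcoef /= -[ltRHS]sqrtr1 ltr_sqrt // mul1r invf_lt1 //.
    by rewrite ltr1n; lia.
  by move=> lt1; rewrite /gap divr_gt0 // exprn_gt0 // subr_gt0.
have gap_sum : 0 < \sum_(a < D) \sum_(c < D) gap a c.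
  have D1 : (0 < D)%N by lia.
  pose o := Ordinal D1.
  rewrite (bigD1 o) //= ltr_wpDr //; first by rewrite !sumr_ge0 // => *; rewrite sumr_ge0.
  by rewrite (bigD1 o) //= ltr_wpDr // sumr_ge0.
have sum_t : \sum_(a < D) \sum_(c < D) t a c = D%:R ^+ 2 - D%:R + 3.
  under eq_bigr do rewrite -mulr_suml -rmorph_sum /=.
  rewrite -mulr_suml -rmorph_sum /= sum_mcoef; last lia.
  rewrite rmorphD rmorphB rmorphM !rmorphXn /=.
  rewrite -[D%:Z%:~R]/(D%:R); field; exact: lt0r_neq0.
have -> : \sum_(a < D) \sum_(c < D) root_mult D a c =
    (D%:R ^+ 2 + \sum_(a < D) \sum_(c < D) t a c) / 2 -
      \sum_(a < D) \sum_(c < D) gap a c.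
  under eq_bigr do under eq_bigr do rewrite gapE.
  under eq_bigr do rewrite big_split /= sumrN -mulr_suml big_split /= sumr_const card_ord.
  rewrite big_split /= sumrN -mulr_suml big_split /= sumr_const card_ord.
  by rewrite -mulrnA mulnn natrX.
rewrite sum_t; have : 3 <= D%:R :> R by rewrite ler_nat.
move: gap_sum; lra.
Qed.
End MeanMultiplier.

Section Weights.
Variables (R : realType) (b : int) (D : nat).
Hypothesis D3 : (2 < D)%N.
Local Notation d := D%:Z.
Local Notation T := (Tmap b d).

Let d2 : 2 <= d. Proof. lia. Qed.

Let Posz_exp k : (D ^ k)%:Z = d ^+ k.
Proof. by rewrite -!natz natrX. Qed.

(** Where the k-step multiplier mprod k x / d ^ k is at least 1, the weight is at
    least 1, so a sum of weights bounds the number of such x. *)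
Definition weight k (x : int * int) : R :=
  Num.sqrt ((mprod b d k x)%:~R / D%:R ^+ k).

Lemma weightS k x :
  weight k.+1 x = Num.sqrt ((mult d x)%:~R / D%:R) * weight k (T x).
Proof.
rewrite /weight -sqrtrM; last first.
  rewrite divr_ge0 // ler0z.
  by have /andP[] := mcoef_bounds (x.1 %% d)%Z (x.2 %% d)%Z d2; rewrite -/(mult d x); lia.
by rewrite mulf_div -intrM exprS.
Qed.

Lemma weight_ge0 k x : 0 <= weight k x.
Proof. exact: sqrtr_ge0. Qed.

Lemma weight_ge1 k x : d ^+ k <= mprod b d k x -> 1 <= weight k x.
Proof.
move=> h; rewrite /weight -[leLHS]sqrtr1 ler_wsqrtr // ler_pdivlMr.
  by rewrite mul1r -[D%:R]/(d%:~R) -rmorphXn ler_int.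
by rewrite exprn_gt0 // ltr0n; lia.
Qed.

Lemma weight_periodic k (x : int * int) (y z : int) :
  weight k (x.1 + (D ^ k)%:Z * y, x.2 + (D ^ k)%:Z * z) = weight k x.
Proof. by rewrite /weight Posz_exp mprod_periodic. Qed.

Lemma coprime_mult x k : coprimez (mult d x) (D ^ k)%:Z.
Proof.
rewrite Posz_exp coprimezXr // /mult /mcoef.
case: ifP => _; first by rewrite coprimezE coprime1n.
case: ifP => _; apply/coprimezP.
  by exists (-1, 1) => /=; lia.
by exists (1, -1) => /=; lia.
Qed.

(** Along uniformly distributed residues the successive multipliers are
    independent: fixing the first residue class, T maps the d ^ k residues in it
    modulo d ^ (k + 1) bijectively onto the residues modulo d ^ k, as the
    multipliers are prime to d. *)
Lemma sum_weight k :
  \sum_(i < D ^ k) \sum_(j < D ^ k) weight k (i%:Z, j%:Z) =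
  (\sum_(a < D) \sum_(c < D) root_mult R D a c) ^+ k.
Proof.
elim: k => [|k IH]; first by rewrite expn0 expr0 !big_ord1 /weight expr0 divr1 sqrtr1.
rewrite exprS -IH mulr_suml expnSr.
rewrite (sum_ord_mul (fun i => \sum_(j < D ^ k * D) weight k.+1 (i%:Z, j%:Z))).
rewrite exchange_big /=; apply: eq_bigr => a _.
under eq_bigr do rewrite (sum_ord_mul (fun j => weight k.+1 (_, j%:Z))).
under eq_bigr do rewrite exchange_big /=.
rewrite exchange_big mulr_suml /=; apply: eq_bigr => c _.
pose x := (a%:Z, c%:Z) : int * int.
have step (p q : nat) : weight k.+1 ((p * D + a)%N%:Z, (q * D + c)%N%:Z) =
   root_mult R D a c * weight k ((mult d x * p%:Z + (T x).1), (mult d x * q%:Z + (T x).2)).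
  have -> : ((p * D + a)%N%:Z, (q * D + c)%N%:Z) = (x.1 + d * p%:Z, x.2 + d * q%:Z).
    by rewrite /x /= !PoszD !PoszM; congr (_, _); ring.
  rewrite weightS mult_shift Tmap_shift // ![_ * _ + _]addrC; congr (Num.sqrt (_%:~R / _) * _).
  by rewrite /mult /= !modz_small //= ltz_nat ltn_ord.
under eq_bigr do under eq_bigr do rewrite step.
under eq_bigr do rewrite -mulr_sumr.
rewrite -mulr_sumr; congr (_ * _).
have cop := coprime_mult x k.
have per1 v : periodic1 (D ^ k) (fun p => weight k (p, v)).
  by move=> p z; have := weight_periodic k (p, v) z 0; rewrite mulr0 addr0.
have per2 u : periodic1 (D ^ k) (fun q => weight k (u, q)).
  by move=> q z; have := weight_periodic k (u, q) 0 z; rewrite mulr0 addr0.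
have sum2 u v : \sum_(q < D ^ k) weight k (u, mult d x * q%:Z + v) =
    \sum_(q < D ^ k) weight k (u, q%:Z) := sum_affine v (per2 u) cop.
transitivity (\sum_(p < D ^ k) \sum_(q < D ^ k)
    weight k (mult d x * p%:Z + (T x).1, q%:Z)).
  by apply: eq_bigr => p _; exact: sum2.
rewrite exchange_big /= [RHS]exchange_big /=; apply: eq_bigr => q _.
exact: (sum_affine _ (per1 _) cop).
Qed.
End Weights.

(** * Density of the stopping set *)

Section StopDensity.
Variables (R : realType) (b d : int).
Hypotheses (d3 : 3 <= d) (b1 : 1 <= b).

Lemma exists_small_expr (q eps : R) : 0 <= q < 1 -> 0 < eps ->
  exists2 k : nat, (1 < k)%N & q ^+ k < eps.
Proof.
move=> /andP[q0 q1] e0.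
have : (fun n => q ^+ n : R) @ \oo --> (0 : R) by apply: cvg_expr; rewrite ger0_norm.
move=> /cvgrPdist_lt /(_ _ e0) [N _ H]; exists (maxn N 2); first by rewrite leq_maxr.
have := H (maxn N 2) (leq_maxl _ _); rewrite /= sub0r normrN ger0_norm //.
exact: exprn_ge0.
Qed.

(** A point that does not stop within k steps is either close to 0 or has weight
    at least 1. The disc is covered by a box [- L N, L N) ^ 2 of full periods
    N = d ^ k, of area about 4 n ^ 2; the loss of the constant factor against
    pi n ^ 2 is harmless, since the mean weight tends to 0 with k. *)
Lemma notStop_count_le (D k : nat) : d = D%:Z -> (1 < k)%N ->
  exists K : R, forall n,
  (disc_count (~` Stop R (Tmap b d)) (n%:R : R))%:R <=
    4 * ((\sum_(a < D) \sum_(c < D) root_mult R D a c) / D%:R ^+ 2) ^+ k * n%:R ^+ 2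
      + K * (n%:R + 1).
Proof.
move=> dD k1; have D2 : (2 < D)%N by lia.
have d2 : 2 <= d by lia.
have [c Hc] := Stop_of_mprod d2 b1 R k1.
set q := _ / _; pose N := (D ^ k)%N.
have N0 : (0 < N)%N by rewrite expn_gt0; lia.
have q0 : 0 <= q.
  rewrite /q divr_ge0 ?exprn_ge0 // sumr_ge0 // => a _.
  by rewrite sumr_ge0 // => e _; exact: sqrtr_ge0.
pose kappa := 4 * q ^+ k.
have kappa0 : 0 <= kappa by rewrite mulr_ge0 ?exprn_ge0.
exists (kappa * (2 * N%:R + N%:R ^+ 2) + (2 * (c%:R + 1)) ^+ 2) => n.
pose L := (n %/ N).+1.
have nLN : (n < L * N)%N by rewrite ltn_ceil.
have LNn : (L * N)%:R <= n%:R + N%:R :> R.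
  by rewrite -natrD ler_nat /L mulSn addnC leq_add2r leq_divM.
rewrite (disc_count_boxsum R _ nLN).
pose small (x : int * int) : R := ((`|x.1| <= c)%N && (`|x.2| <= c)%N)%:R.
apply: (@le_trans _ _ (boxsum (L * N) (fun x => weight R b D k x + small x))).
  apply: ler_boxsum => x _ _; case: asboolP => [[nS _]|_]; last first.
    by rewrite addr_ge0 ?weight_ge0 // /small ler0n.
  rewrite /small; case: (boolP (_ && _)) => [_|big]; first by apply: ler_wpDl => //; exact: weight_ge0.
  rewrite addr0 weight_ge1 //; rewrite leNgt; apply/negP => lt; apply: nS.
  by apply: Hc; rewrite // dD.
rewrite boxsumD.
have -> : boxsum (L * N) (weight R b D k) = kappa * (L * N)%:R ^+ 2.
  rewrite boxsum_periodic => [|x y z]; last exact: weight_periodic.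
  rewrite -/N sum_weight // /kappa /q expr_div_n !natrM /N natrX (exprAC _ 2 k).
  have : D%:R ^+ k != 0 :> R by rewrite expf_neq0 // pnatr_eq0; lia.
  set S := (\sum_(a < D) _) ^+ k; move: S (D%:R ^+ k) => S x x0.
  by field.
have hs := boxsum_small_le R (L * N) c.
have h2 : kappa * (L * N)%:R ^+ 2 <= kappa * (n%:R + N%:R) ^+ 2.
  by rewrite ler_wpM2l // lerXn2r ?nnegrE ?addr_ge0.
apply: (le_trans (lerD h2 hs)).
have n0 : 0 <= n%:R :> R by [].
have nN : 0 <= kappa * (n%:R * N%:R ^+ 2) by rewrite !mulr_ge0 ?exprn_ge0.
have kN : 0 <= kappa * N%:R by rewrite mulr_ge0.
have cn : 0 <= (2 * (c%:R + 1)) ^+ 2 * n%:R :> R by rewrite mulr_ge0 ?sqr_ge0.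
rewrite -/kappa; set s := (2 * (c%:R + 1)) ^+ 2 in cn *.
by move: s cn nN kN; move: kappa (n%:R : R) (N%:R : R) {kappa0 h2 q0} => y u v s; lra.
Qed.

Lemma has_density_Stop : has_density (Stop R (Tmap b d)) (1 : R).
Proof.
have [D dD] : exists D : nat, d = D%:Z by exists (absz d); lia.
have D2 : (2 < D)%N by lia.
suff ge1 : 1 <= lower_density R (Stop R (Tmap b d)).
  have lu := lower_density_le_upper R (Stop R (Tmap b d)).
  have u1 := upper_density_le1 R (Stop R (Tmap b d)).
  by split; apply/eqP; rewrite eq_le; apply/andP; split => //; lra.
apply/ler_addgt0Pl => e e0.
pose q : R := (\sum_(a < D) \sum_(c < D) root_mult R D a c) / D%:R ^+ 2.
have DD : 0 < D%:R ^+ 2 :> R by rewrite exprn_gt0 // ltr0n; lia.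
have q01 : 0 <= q < 1.
  rewrite /q ltr_pdivrMr // mul1r sum_root_mult_lt // andbT.
  rewrite divr_ge0 ?exprn_ge0 // sumr_ge0 // => a _.
  by rewrite sumr_ge0 // => c _; exact: sqrtr_ge0.
have [k k1 qk] := exists_small_expr q01 (divr_gt0 e0 (ltr0Sn R 3)).
have [K HK] := notStop_count_le dD k1.
have q0 : 0 <= q ^+ k by case/andP: q01 => ? _; rewrite exprn_ge0.
have := @lower_density_ge R (Stop R (Tmap b d)) (4 * q ^+ k) K.
move=> /(_ _ (fun n _ => HK n)); rewrite mulr_ge0 // => /(_ isT).
have : pi^-1 * (4 * q ^+ k) <= 4 * q ^+ k.
  rewrite ler_piMl ?mulr_ge0 // invf_le1 ?pi_gt0 //.
  by have := pi_ge2 R; lra.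
lra.
Qed.
End StopDensity.

Close Scope classical_set_scope.

Theorem proposition3 (R : realType) :
  (forall d b : int, 2 <= d -> 1 <= b ->
     1 - pi^-1 * acos (1 / Num.sqrt (1 + ((b * d)%:~R : R) ^- 2))
       <= lower_density R (Div (Tmap b d)))
  /\
  (forall eps : R, 0 < eps ->
     exists N : int, forall d b : int, 2 <= d -> 1 <= b -> N <= b * d ->
       `|lower_density R (Div (Tmap b d)) - 1| < eps)
  /\
  (forall d b : int, 3 <= d -> 1 <= b ->
     has_density (Stop R (Tmap b d)) (1 : R)).
Proof.
split; first by move=> d b; exact: lower_density_Div_ge.
split; first exact: lower_density_Div_near1.
by move=> d b; exact: has_density_Stop.
Qed.
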